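(* Let $\omega$ be a subadditive weight, let $a>2$ and let $\sigma(t)=\omega(t^{1/a})$ for $t\ge0$. Let $\psi$ be a polynomial with real coefficients, of degree greater than one and without fixed points (i.e. $\psi(x)\neq x$ for all $x\in\mathbb{R}$), and let $\mu\in\mathbb{C}$, $\mu\ne0$. Then $R_\mu\in\mathcal{L}(\mathcal{S}_\omega(\mathbb{R}),\mathcal{S}_\sigma(\mathbb{R}))$; that is, $R_\mu$ maps $\mathcal{S}_\omega(\mathbb{R})$ into $\mathcal{S}_\sigma(\mathbb{R})$ and $R_\mu:\mathcal{S}_\omega(\mathbb{R})\to\mathcal{S}_\sigma(\mathbb{R})$ is continuous.
   Context: $\mathbb{N}_0=\{0,1,2,\dots\}$. A weight is a continuous increasing function $\omega:[0,\infty[\to[0,\infty[$ such that: $(\alpha)$ there is $K\ge 1$ with $\omega(2t)\le K(\omega(t)+1)$ for all $t\ge 0$; $(\beta)$ $\int_0^\infty \frac{\omega(t)}{1+t^2}\,dt<\infty$; $(\gamma)$ $\log(1+t^2)=o(\omega(t))$ as $t\to\infty$; $(\delta)$ $\varphi_\omega(t):=\omega(e^t)$ is convex. It is subadditive if $\omega(s+t)\le\omega(s)+\omega(t)$ for all $s,t\ge 0$. The Young conjugate of $\varphi_\omega$ is $\varphi_\omega^*(s)=\sup\{st-\varphi_\omega(t): t\ge 0\}$, $s\ge 0$. The Gelfand-Shilov space of Beurling type $\mathcal{S}_\omega(\mathbb{R})$ is the space of all $f\in C^\infty(\mathbb{R})$ (complex valued) with $$\|f\|_{\omega,\lambda}:=\sup_{x\in\mathbb{R}}\sup_{n,q\in\mathbb{N}_0}(1+|x|)^q|f^{(n)}(x)|\exp\left(-\lambda\varphi_\omega^*\left(\tfrac{n+q}{\lambda}\right)\right)<\infty\quad\text{for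 every }\lambda>0,$$ a Fréchet space with the topology given by these seminorms; it is contained in the Schwartz space $\mathcal{S}(\mathbb{R})$. $C_\psi$ is the composition operator $f\mapsto f\circ\psi$ and $\psi_m$ is the $m$-th iterate of $\psi$ ($\psi_0$ the identity). It is known that for a real polynomial $\psi$ of degree greater than one without fixed points and any $\mu\in\mathbb{C}\setminus\{0\}$, the operator $\mu-C_\psi=\mu I-C_\psi$ is a topological isomorphism of $\mathcal{S}(\mathbb{R})$ onto itself; $R_\mu:=(\mu-C_\psi)^{-1}:\mathcal{S}(\mathbb{R})\to\mathcal{S}(\mathbb{R})$ denotes its inverse, and $R_\mu f=\sum_{m=0}^\infty\frac{C_{\psi_m}f}{\mu^{m+1}}$ with convergence in $\mathcal{S}(\mathbb{R})$. *)

(* Defs.v *)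
From HB Require Import structures.
From mathcomp Require Import all_boot all_order all_algebra.
From mathcomp Require Import complex.
From mathcomp Require Import all_classical all_reals all_analysis.

Set Implicit Arguments.
Unset Strict Implicit.
Unset Printing Implicit Defensive.

Import Order.TTheory GRing.Theory Num.Theory.
Import numFieldNormedType.Exports.
Import ComplexField.Normc.

Local Open Scope classical_set_scope.
Local Open Scope ring_scope.
Local Open Scope complex_scope.

(* A weight lives on [0, +oo[; it is represented by a total function whose
   values at negative arguments are irrelevant. *)
Record is_weight (R : realType) (omega : R -> R) : Prop := IsWeight {
  weight_ge0 : forall t : R, 0 <= t -> 0 <= omega t;
  weight_continuous : {within `[0, +oo[, continuous omega};
  weight_nondecreasing : forall s t : R, 0 <= s -> s <= t -> omega s <= omega t;
  weight_alpha : exists2 K, 1 <= K &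
    forall t : R, 0 <= t -> omega (2 * t) <= K * (omega t + 1);
  weight_beta :
    (\int[lebesgue_measure]_(t in `[0%R, +oo[) (omega t / (1 + t ^+ 2))%:E
      < +oo)%E;
  weight_gamma : forall eps, 0 < eps ->
    \forall t \near +oo, `|ln (1 + t ^+ 2)| <= eps * `|omega t|;
  weight_delta :
    convex_function [set: convex_lmodType R^o] (fun t : R => omega (expR t))
}.

Definition subadditive_weight (R : realType) (omega : R -> R) : Prop :=
  is_weight omega /\
  forall s t : R, 0 <= s -> 0 <= t -> omega (s + t) <= omega s + omega t.

(* The supremum is finite for every weight, by [weight_gamma]. *)
Definition young_conjugate (R : realType) (omega : R -> R) (s : R) : R :=
  sup [set s * t - omega (expR t) | t in [set t | 0 <= t]].

Section ComplexValuedFunctions.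
Variable R : realType.
Implicit Types f : R -> R[i].

(* Derivatives of a complex-valued function of a real variable are taken on
   its real and imaginary parts. *)
Definition smooth f : Prop := forall n x,
  derivable (derive1n n (fun y => complex.Re (f y))) x 1 /\
  derivable (derive1n n (fun y => complex.Im (f y))) x 1.

Definition cderiven n f (x : R) : R[i] :=
  derive1n n (fun y => complex.Re (f y)) x +i* derive1n n (fun y => complex.Im (f y)) x.

Definition schwartz : set (R -> R[i]) :=
  [set f | smooth f /\ forall n q : nat, exists M : R, forall x,
    (1 + `|x|) ^+ q * normc (cderiven n f x) <= M].

End ComplexValuedFunctions.

Definition gs_seminorm (R : realType) (omega : R -> R) (lambda : R)
    (f : R -> R[i]) : \bar R :=
  ereal_sup [set y | exists (x : R) (n q : nat),
    y = ((1 + `|x|) ^+ q * normc (cderiven n f x) *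
         expR (- (lambda * young_conjugate omega ((n + q)%:R / lambda))))%:E].

Definition gelfand_shilov (R : realType) (omega : R -> R) : set (R -> R[i]) :=
  [set f | smooth f /\
    forall lambda, 0 < lambda -> (gs_seminorm omega lambda f < +oo)%E].

Section Closure.
Variable R : realType.
Implicit Types (h k : R -> R) (f g : R -> R[i]).

Lemma derive1n_lin (a b : R) h k :
  (forall n x, derivable (derive1n n h) x 1) -> (forall n x, derivable (derive1n n k) x 1) ->
  forall n, (derive1n n (fun x => a * h x + b * k x)) =
            (fun x => a * (derive1n n h) x + b * (derive1n n k) x) /\
    forall x, derivable (derive1n n (fun x => a * h x + b * k x)) x 1.
Proof.
move=> dh dk n.
have dlin m x : derivable (fun x => a * (derive1n m h) x + b * (derive1n m k) x) x 1.
  exact: derivableD (derivableZ _) (derivableZ _).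
suff E m : (derive1n m (fun x => a * h x + b * k x)) =
    (fun x => a * (derive1n m h) x + b * (derive1n m k) x).
  by split=> // x; rewrite E.
elim: m => [//|m IH]; rewrite !derive1nS IH; apply/funext => x.
rewrite !derive1E (_ : (fun _ => _) = a *: (derive1n m h) + b *: (derive1n m k)) //.
by rewrite deriveD ?deriveZ //; exact: derivableZ.
Qed.

Lemma smooth_lin (c : R[i]) f g : smooth f -> smooth g ->
  smooth (c *: f + g) /\
  forall n x, cderiven n (c *: f + g) x = c * cderiven n f x + cderiven n g x.
Proof.
case: c => a b sf sg.
have df n x := (sf n x).1; have df' n x := (sf n x).2.
have dg n x := (sg n x).1; have dg' n x := (sg n x).2.
have L1 := derive1n_lin a (- b) df df'.
have L2 := derive1n_lin a b df' df.
have M1 := derive1n_lin 1 1 (fun n x => (L1 n).2 x) dg.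
have M2 := derive1n_lin 1 1 (fun n x => (L2 n).2 x) dg'.
have E1 : (fun y => complex.Re (((a +i* b) *: f + g) y)) = (fun y =>
    1 * (a * complex.Re (f y) + - b * complex.Im (f y)) + 1 * complex.Re (g y)).
  apply/funext => y; rewrite !mul1r mulNr.
  rewrite -[((a +i* b) *: f + g) y]/((a +i* b) * f y + g y).
  by case: (f y) (g y) => [p q] [r s].
have E2 : (fun y => complex.Im (((a +i* b) *: f + g) y)) = (fun y =>
    1 * (a * complex.Im (f y) + b * complex.Re (f y)) + 1 * complex.Im (g y)).
  apply/funext => y; rewrite !mul1r.
  rewrite -[((a +i* b) *: f + g) y]/((a +i* b) * f y + g y).
  by case: (f y) (g y) => [p q] [r s].
split=> n x; first by rewrite E1 E2; split; [exact: (M1 n).2|exact: (M2 n).2].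
rewrite /cderiven E1 E2 (M1 n).1 (M2 n).1 (L1 n).1 (L2 n).1.
by rewrite !mul1r mulNr.
Qed.

Lemma smooth0 : smooth (0 : R -> R[i]) /\ forall n x, cderiven n (0 : R -> R[i]) x = 0.
Proof.
have z n : derive1n n (cst 0 : R -> R) = cst 0.
  by elim: n => [//|n IH]; rewrite derive1nS IH; apply/funext => x; rewrite derive1_cst.
split=> n x; last by rewrite -[LHS]/(derive1n n (cst 0) x +i* derive1n n (cst 0) x) z.
rewrite -[X in X /\ _]/(derivable (derive1n n (cst 0)) x 1).
rewrite -[X in _ /\ X]/(derivable (derive1n n (cst 0)) x 1) z.
by split; exact: derivable_cst.
Qed.

Lemma gs_seminorm_ltP (omega : R -> R) lambda f :
  (gs_seminorm omega lambda f < +oo)%E <->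
  exists M : R, forall x (n q : nat),
    (1 + `|x|) ^+ q * normc (cderiven n f x) *
      expR (- (lambda * young_conjugate omega ((n + q)%:R / lambda))) <= M.
Proof.
split=> [fin|[M bM]]; last first.
  apply: (@le_lt_trans _ _ M%:E); last exact: ltry.
  by apply: ge_ereal_sup => _ [x [n [q ->]]]; rewrite lee_fin.
have ub x (n q : nat) := @ereal_sup_ubound _ _ _
  (ex_intro _ x (ex_intro _ n (ex_intro _ q erefl))) : (_ <= gs_seminorm omega lambda f)%E.
case E : (gs_seminorm omega lambda f) fin ub => [M| |] // _ ub.
- by exists M => x n q; have := ub x n q; rewrite lee_fin.
- by have := ub 0 0%N 0%N; rewrite leeNy_eq.
Qed.

Lemma gelfand_shilov_submod (omega : R -> R) :
  GRing.submod_closed (mem (gelfand_shilov omega)).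
Proof.
split.
- rewrite inE; split; first exact: smooth0.1.
  move=> l _; apply/gs_seminorm_ltP; exists 0 => x n q.
  by rewrite smooth0.2 normc0 mulr0 mul0r.
- move=> c f g; rewrite !inE => -[sf bf] [sg bg].
  have [s e] := smooth_lin c sf sg; split=> // l l0.
  have /gs_seminorm_ltP[M hM] := bf l l0; have /gs_seminorm_ltP[N hN] := bg l l0.
  apply/gs_seminorm_ltP; exists (normc c * M + N) => x n q; rewrite e.
  set w := expR _.
  have hq : 0 <= (1 + `|x|) ^+ q by rewrite exprn_ge0 // addr_ge0.
  apply: (@le_trans _ _ (normc c * ((1 + `|x|) ^+ q * normc (cderiven n f x) * w) +
     (1 + `|x|) ^+ q * normc (cderiven n g x) * w)).
    rewrite (mulrA (normc c)) (mulrCA (normc c)) -mulrDl -mulrDr.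
    rewrite ler_wpM2r ?expR_ge0 // ler_wpM2l //.
    by rewrite -normcM; exact: le_normcD.
  apply: lerD; [apply: ler_wpM2l; [|exact: hM]|exact: hN].
  by case: (c) => ? ?; rewrite /normc sqrtr_ge0.
Qed.

End Closure.

Section GelfandShilovSpace.
Variables (R : realType) (omega : R -> R).

Definition in_gelfand_shilov : {pred R -> R[i]} := mem (gelfand_shilov omega).

Record gelfand_shilov_space : Type := GelfandShilovSpace {
  gs_fun :> R -> R[i];
  _ : gs_fun \in in_gelfand_shilov
}.

HB.instance Definition _ := [isSub for gs_fun].
HB.instance Definition _ := [Choice of gelfand_shilov_space by <:].
HB.instance Definition _ := GRing.isSubmodClosed.Build _ _ in_gelfand_shilov
  (gelfand_shilov_submod omega).
HB.instance Definition _ :=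
  [SubChoice_isSubLmodule of gelfand_shilov_space by <:].

(* The locally convex topology of the seminorms: the open seminorm balls form
   a subbase. *)
Definition seminorm_ball (lambda eps : R) (f : gelfand_shilov_space) :
    set gelfand_shilov_space :=
  [set g | (gs_seminorm omega lambda (gs_fun (g - f)%R) < eps%:E)%E].

HB.instance Definition _ := isSubBaseTopological.Build gelfand_shilov_space
  [set B | exists lambda eps f,
     [/\ 0 < lambda, 0 < eps & B = seminorm_ball lambda eps f]] id.

End GelfandShilovSpace.

Section Resolvent.
Variables (R : realType) (mu : R[i]) (psi : R -> R).
Implicit Types f : R -> R[i].

Definition mu_sub_comp f : R -> R[i] := fun x => mu * f x - f (psi x).

(* [Rmu] is the inverse of [mu_sub_comp] as a map of the Schwartz space onto
   itself; its values outside that space are irrelevant. *)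
Definition is_resolvent (Rmu : (R -> R[i]) -> R -> R[i]) : Prop :=
  [/\ forall f, schwartz f -> schwartz (Rmu f),
      forall f, schwartz f -> Rmu (mu_sub_comp f) = f &
      forall f, schwartz f -> mu_sub_comp (Rmu f) = f].

End Resolvent.

(* Main.v *)
(* Iterating mu g = f + g o psi for g = R_mu f gives
   g = sum_(m < N) mu^(-m-1) f o psi_m + mu^(-N) g o psi_N, so it is enough to
   bound the derivatives of f o psi_m by (|mu|/2)^m times the right quantity.
   With y = psi_m(x), the Taylor coefficients of psi_m(x + h) - y have weighted
   l^1 norm at most 1 + |y| at the radius D^-m, where D depends on psi only, so
   the Faa di Bruno formula gives
     |(f o psi_m)^(n)(x)|
       <= sum_(k <= n) n!/k! D^(mn) (1 + |y|)^k |f^(k)(y)|.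
   Now count derivatives plus powers of 1 + |y|: the k-th term uses 2k of them,
   (1 + |x|)^q uses q, and D^(mn) uses n/N + 1 for any fixed N, since the absence
   of fixed points makes |psi_m| outgrow every geometric sequence uniformly in
   x.  As omega(n) <= n omega(1), the factor n!/k! costs n - k more, up to a
   geometric factor.  The total (2 + 1/N) n + q + O(1) is at most a (n + q) up to
   a constant when 1/N < a - 2, with room left to absorb the geometric factors,
   and phi_sigma^*(s) = phi_omega^*(a s). *)
Require Import Defs.
From HB Require Import structures.
From mathcomp Require Import all_boot all_order all_algebra.
From mathcomp Require Import complex.
From mathcomp Require Import all_classical all_reals all_analysis.
From mathcomp Require Import ring lra.
Import Order.TTheory GRing.Theory Num.Theory.
Import numFieldNormedType.Exports.
Set Implicit Arguments.
Unset Strict Implicit.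
Unset Printing Implicit Defensive.
Import ComplexField.Normc.
Local Open Scope classical_set_scope.
Local Open Scope ring_scope.
Local Open Scope complex_scope.

(** * Weighted l^1 norms of polynomial coefficients *)

(* The coefficients of p have weighted l^1 norm at most d at the radius r; a
   majorant makes this condition visibly stable under sums and products. *)
Definition majorized {R : numDomainType} (r d : R) (p : {poly R}) : Prop :=
  exists2 q : {poly R}, forall i, `|p`_i| <= q`_i & q.[r] <= d.

Section Majorized.
Variables (R : realFieldType) (r : R).
Hypothesis r_ge0 : 0 <= r.
Implicit Types (p q : {poly R}) (c d e : R).

Lemma le_majorized d e p : d <= e -> majorized r d p -> majorized r e p.
Proof. by move=> de [q pq qd]; exists q => //; exact: le_trans de. Qed.

Lemma majorized_coef d p n : majorized r d p -> `|p`_n| * r ^+ n <= d.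
Proof.
move=> [q pq qd]; have q0 i : 0 <= q`_i by exact: le_trans (pq i).
apply: le_trans qd; apply: (@le_trans _ _ (q`_n * r ^+ n)).
  by rewrite ler_wpM2r ?exprn_ge0.
rewrite horner_coef; have [nq|qn] := ltnP n (size q); last first.
  by rewrite nth_default// mul0r sumr_ge0// => i _; rewrite mulr_ge0 ?exprn_ge0.
rewrite (bigD1 (Ordinal nq))//= lerDl sumr_ge0// => i _.
by rewrite mulr_ge0 ?exprn_ge0.
Qed.

Lemma majorized_ge0 d p : majorized r d p -> 0 <= d.
Proof.
by move=> /majorized_coef-/(_ 0%N); apply: le_trans; rewrite mulr_ge0 ?exprn_ge0.
Qed.

Lemma majorizedC c : majorized r `|c| c%:P.
Proof.
exists `|c|%:P; last by rewrite hornerC.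
by move=> i; rewrite !coefC; case: ifP; rewrite ?normr0.
Qed.

Lemma majorizedX : majorized r r 'X.
Proof.
exists 'X; last by rewrite hornerX.
by move=> i; rewrite !coefX; case: (_ == _); rewrite ?normr0 ?normr1.
Qed.

Lemma majorizedD d e p q :
  majorized r d p -> majorized r e q -> majorized r (d + e) (p + q).
Proof.
move=> [p' pp' p'd] [q' qq' q'e]; exists (p' + q'); last by rewrite hornerD lerD.
by move=> i; rewrite !coefD (le_trans (ler_normD _ _))// lerD.
Qed.

Lemma majorizedM d e p q :
  majorized r d p -> majorized r e q -> majorized r (d * e) (p * q).
Proof.
move=> [p' pp' p'd] [q' qq' q'e]; exists (p' * q'); last first.
  have p'0 i : 0 <= p'`_i by exact: le_trans (pp' i).
  have q'0 i : 0 <= q'`_i by exact: le_trans (qq' i).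
  rewrite hornerM ler_pM//.
  - by rewrite horner_coef sumr_ge0// => i _; rewrite mulr_ge0// exprn_ge0.
  - by rewrite horner_coef sumr_ge0// => i _; rewrite mulr_ge0// exprn_ge0.
move=> i; rewrite !coefM (le_trans (ler_norm_sum _ _ _))// ler_sum// => j _.
by rewrite normrM ler_pM.
Qed.

Lemma majorizedXn d p n : majorized r d p -> majorized r (d ^+ n) (p ^+ n).
Proof.
move=> pd; elim: n => [|n IH]; last by rewrite !exprS; exact: majorizedM.
by have := majorizedC 1; rewrite normr1.
Qed.

Lemma majorized_sum (I : Type) (s : seq I) (d : I -> R) (p : I -> {poly R}) :
  (forall i, majorized r (d i) (p i)) ->
  majorized r (\sum_(i <- s) d i) (\sum_(i <- s) p i).
Proof.
move=> pd; elim: s => [|i s IH]; last by rewrite !big_cons; exact: majorizedD.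
by rewrite !big_nil; have := majorizedC 0; rewrite normr0.
Qed.

(** Induction through p^(n+1) - y^(n+1) = p^n (p - y) + y (p^n - y^n), where [p] itself has norm at
    most |y| + d. The explicit factor [d] is what later limits the growth of the deviation to a
    constant per composition. *)
Lemma majorized_subXn d p y n : majorized r d (p - y%:P) ->
  majorized r (n%:R * d * (`|y| + d) ^+ n.-1) (p ^+ n - (y ^+ n)%:P).
Proof.
move=> pd; have d0 := majorized_ge0 pd.
have pyd : majorized r (`|y| + d) p.
  by rewrite -[p](subrK y%:P) addrC; apply: majorizedD => //; exact: majorizedC.
elim: n => [|n IH].
  by rewrite !expr0 subrr !mul0r; have := majorizedC 0; rewrite normr0.
rewrite (_ : _ - _ = p ^+ n * (p - y%:P) + y%:P * (p ^+ n - (y ^+ n)%:P)); last first.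
  by rewrite !exprS polyCM; ring.
have := majorizedD (majorizedM (majorizedXn n pyd) pd)
  (majorizedM (majorizedC y) IH).
apply: le_majorized; rewrite /= -natr1 mulrDl mul1r mulrDl [leRHS]addrC mulrC lerD2l.
case: n {IH} => [|n] /=; first by rewrite !mul0r mulr0.
rewrite mulrCA exprS ler_wpM2l ?mulr_ge0//.
by rewrite ler_wpM2r ?exprn_ge0 ?addr_ge0// lerDl.
Qed.

End Majorized.

(** * Lower bounds for a polynomial by its leading power *)

Section PolynomialGrowth.
Variable R : realFieldType.
Implicit Types (psi : {poly R}) (x y : R).

(** A mean value bound: with z = 1 + |y| it trades |y|^n for (1 + |y|)^n at the cost of a
    lower-order term. *)
Lemma subrX1_le (z : R) n : 1 <= z -> z ^+ n <= (z - 1) ^+ n + n%:R * z ^+ n.-1.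
Proof.
move=> z1; elim: n => [|n IH]; first by rewrite !expr0 mul0r addr0.
have z0 : 0 <= z by exact: le_trans z1.
have h : (z - 1) ^+ n <= z ^+ n by rewrite lerXn2r// ?nnegrE ?subr_ge0// gerBl.
rewrite exprS; apply: (le_trans (ler_wpM2l z0 IH)).
rewrite mulrDr -[X in X * (z - 1) ^+ n](subrK 1) mulrDl -exprS -addrA lerD2l mul1r.
rewrite -natr1 mulrDl mul1r addrC lerD//.
by case: n {IH h} => [|n] /=; rewrite ?mul0r ?mulr0// mulrCA -exprS.
Qed.

(** The leading term dominates once 1 + |y| passes a threshold; below it the left side is bounded,
    and [K] covers it. *)
Lemma expr_le_horner psi : (0 < size psi)%N ->
  exists2 K, 1 <= K & forall y, (1 + `|y|) ^+ (size psi).-1 <= K * (1 + `|psi.[y]|).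
Proof.
move=> psi_gt0.
set l := `|lead_coef psi|; set p := (size psi).-1.
have l0 : 0 < l by rewrite normr_gt0 lead_coef_eq0 -size_poly_gt0.
(* [B] collects the lower coefficients and the cost of replacing |y|^p by (1 + |y|)^p. *)
set B := \sum_(i < p) `|psi`_i| + p%:R * l.
have B0 : 0 <= B by rewrite addr_ge0 ?mulr_ge0 ?sumr_ge0// ltW.
have key y : l * (1 + `|y|) ^+ p <= `|psi.[y]| + B * (1 + `|y|) ^+ p.-1.
  set z := 1 + `|y|; have z1 : 1 <= z by rewrite lerDl.
  have zy : z - 1 = `|y| by rewrite addrC addKr.
  apply: (le_trans (ler_wpM2l (ltW l0) (subrX1_le p z1))).
  rewrite mulrDr zy [B * _]mulrDl addrA [_ * l]mulrC mulrA lerD2r.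
  have -> : psi.[y] = \sum_(i < p) psi`_i * y ^+ i + lead_coef psi * y ^+ p.
    by rewrite horner_coef -(prednK psi_gt0) big_ord_recr /= -lead_coefE.
  set s := \sum_(i < p) _ * _; rewrite -lerBlDr.
  have sle : `|s| <= (\sum_(i < p) `|psi`_i|) * z ^+ p.-1.
    rewrite (le_trans (ler_norm_sum _ _ _))// mulr_suml ler_sum// => i _.
    rewrite normrM ler_wpM2l// normrX.
    apply: (@le_trans _ _ (z ^+ i)); last first.
      by rewrite ler_weXn2l// -ltnS (leq_trans (ltn_ord i))// leqSpred.
    by rewrite lerXn2r ?nnegrE ?(le_trans ler01 z1)// /z lerDr.
  have -> : l * `|y| ^+ p = `|lead_coef psi * y ^+ p| by rewrite normrM normrX.
  have := ler_normB (s + lead_coef psi * y ^+ p) s; rewrite [_ + _ - _]addrAC subrr add0r.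
  by move: sle; lra.
have e0 : 0 <= (2 * B / l) ^+ p.
  by rewrite exprn_ge0 ?divr_ge0 ?mulr_ge0// ltW.
have l20 : 0 <= 2 / l by rewrite divr_ge0// ltW.
exists (1 + 2 / l + (2 * B / l) ^+ p); first by rewrite -addrA lerDl addr_ge0.
move=> y; have := key y; set z := 1 + `|y| => hz.
have z1 : 1 <= z by rewrite lerDl.
have psi0 := normr_ge0 psi.[y].
have [zB|Bz] := leP z (2 * B / l).
  have hzp : z ^+ p <= (2 * B / l) ^+ p.
    by rewrite lerXn2r ?nnegrE// (le_trans ler01)// (le_trans z1).
  apply: (le_trans hzp); apply: (@le_trans _ _ (1 + 2 / l + (2 * B / l) ^+ p)).
    by rewrite lerDr addr_ge0.
  by rewrite ler_peMr ?lerDl// !addr_ge0.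
(* Past the threshold 2B/l the lower-order part takes at most half of the leading one; for p = 0 the
   constant [B] is zero. *)
have hB : B * z ^+ p.-1 <= l / 2 * z ^+ p.
  have [p0|p0] := posnP p.
    by rewrite /B p0 big_ord0 mul0r addr0 mul0r mulr_ge0// divr_ge0// ltW.
  rewrite -{2}(prednK p0) exprS mulrA ler_wpM2r ?exprn_ge0 ?(le_trans ler01)//.
  by move: Bz; rewrite ltr_pdivrMr// => /ltW; lra.
have : l / 2 * z ^+ p <= `|psi.[y]| by lra.
rewrite -ler_pdivlMl ?divr_gt0// invf_div => /le_trans; apply.
apply: (@le_trans _ _ (2 / l * (1 + `|psi.[y]|))); first by rewrite ler_wpM2l// lerDr.
by rewrite ler_wpM2r ?addr_ge0//; lra.
Qed.

End PolynomialGrowth.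

(** * Taylor coefficients and size of the iterates *)

Definition poly_iter {R : nzSemiRingType} (psi : {poly R}) (m : nat) : {poly R} :=
  iter m (fun u => psi \Po u) 'X.

Lemma horner_poly_iterS {R : comNzSemiRingType} (psi : {poly R}) m (x : R) :
  (poly_iter psi m.+1).[x] = psi.[(poly_iter psi m).[x]].
Proof. exact: horner_comp. Qed.

Section Iterates.
Variable R : realFieldType.
Implicit Types (psi : {poly R}) (x y : R).

(** In psi(u) - psi(y) = sum psi_i (u^i - y^i), [majorized_subXn] and d <= 1 bound each summand by a
    multiple of d (1 + |y|)^i, and [expr_le_horner] compares the top power with 1 + |psi(y)|. So the
    deviation relative to 1 + |y| grows at most by [D], whatever y is. *)
Lemma majorized_comp psi : (1 < size psi)%N ->
  exists2 D, 1 <= D & forall r d y (u : {poly R}), 0 <= r -> d <= 1 ->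
    majorized r (d * (1 + `|y|)) (u - y%:P) ->
    majorized r (D * d * (1 + `|psi.[y]|)) (psi \Po u - psi.[y]%:P).
Proof.
move=> psi_gt1; have psi_gt0 : (0 < size psi)%N by exact: ltnW.
have [K K1 Kp] := expr_le_horner psi_gt0.
set S := \sum_(i < size psi) `|psi`_i| * (i%:R * 2 ^+ i.-1).
have S0 : 0 <= S by rewrite sumr_ge0// => i _; rewrite !mulr_ge0// exprn_ge0.
exists (1 + S * K); first by rewrite lerDl mulr_ge0// (le_trans ler01).
move=> r d y u r0 d1 uy; have := majorized_ge0 r0 uy.
have z0 : 0 < 1 + `|y| by rewrite ltr_wpDr.
rewrite pmulr_lge0// => d0.
have {uy} h i := majorizedM r0 (majorizedC r psi`_i) (majorized_subXn r0 i uy).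
rewrite comp_polyE horner_coef rmorph_sum -sumrB.
rewrite (eq_bigr (fun i : 'I__ => (psi`_i)%:P * (u ^+ i - (y ^+ i)%:P))); last first.
  by move=> i _; rewrite mulrBr -polyCM mul_polyC.
have := majorized_sum (index_enum 'I_(size psi)) (fun i : 'I__ => h i).
apply: le_majorized.
apply: (@le_trans _ _ (S * d * (1 + `|y|) ^+ (size psi).-1)).
  rewrite -mulrA /S mulr_suml ler_sum// => i _.
  rewrite -!mulrA ler_wpM2l//.
  case: (nat_of_ord i) (ltn_ord i) => [|j] ji /=; first by rewrite !mul0r.
  rewrite ler_wpM2l//.
  rewrite [leRHS]mulrCA ler_wpM2l//.
  have -> : (size psi).-1 = (size psi).-2.+1 by rewrite prednK// -subn1 subn_gt0.
  rewrite exprS [leRHS]mulrCA ler_wpM2l ?(ltW z0)//.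
  apply: (@le_trans _ _ ((2 * (1 + `|y|)) ^+ j)).
    rewrite lerXn2r ?nnegrE ?addr_ge0 ?mulr_ge0 ?addr_ge0//.
    have : d * (1 + `|y|) <= 1 * (1 + `|y|) by rewrite ler_wpM2r// ltW.
    by move: z0; lra.
  rewrite exprMn ler_wpM2l ?exprn_ge0// ler_weXn2l ?lerDl//.
  by rewrite -ltnS -ltnS prednK ?prednK// -subn1 subn_gt0.
apply: (@le_trans _ _ (S * d * (K * (1 + `|psi.[y]|)))).
  by rewrite ler_wpM2l ?mulr_ge0.
rewrite -horner_coef.
have -> : (1 + S * K) * d * (1 + `|psi.[y]|) =
    S * d * (K * (1 + `|psi.[y]|)) + d * (1 + `|psi.[y]|) by ring.
by rewrite lerDl mulr_ge0// addr_ge0.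
Qed.

Lemma majorized_poly_iter psi : (1 < size psi)%N ->
  exists2 D, 1 <= D & forall m x, majorized (D ^- m)
    (1 + `|(poly_iter psi m).[x]|)
    (poly_iter psi m \Po ('X + x%:P) - (poly_iter psi m).[x]%:P).
Proof.
move=> /majorized_comp[D D1 HD]; exists D => // m x.
have D0 : 0 < D by exact: lt_le_trans D1.
have r0 : 0 <= D ^- m by rewrite invr_ge0 exprn_ge0// ltW.
(* At the fixed radius D^-m the relative deviation starts at D^-m and gains a factor D per
   composition, so it is at most 1 before each of the m compositions, as [majorized_comp]
   requires. *)
have : forall j, (j <= m)%N -> majorized (D ^- m)
    (D ^+ j / D ^+ m * (1 + `|(poly_iter psi j).[x]|))
    (poly_iter psi j \Po ('X + x%:P) - (poly_iter psi j).[x]%:P).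
  elim=> [_|j IH jm].
    rewrite /= comp_polyX hornerX addrK expr0 mul1r.
    apply: le_majorized (majorizedX _).
    by rewrite ler_peMr// lerDl.
  rewrite horner_poly_iterS /= -comp_polyA exprS -[D * _ / _]mulrA.
  apply: HD => //; last by apply: IH; exact: ltnW.
  by rewrite ler_pdivrMr ?exprn_gt0// mul1r ler_weXn2l// ltnW.
by move=> /(_ m (leqnn m)); rewrite divff ?mul1r// expf_neq0// gt_eqF.
Qed.

(** A Cauchy estimate at the radius D^-m. *)
Lemma norm_coef_poly_iterXn psi : (1 < size psi)%N ->
  exists2 D, 1 <= D & forall m x k n,
    `|((poly_iter psi m \Po ('X + x%:P) - (poly_iter psi m).[x]%:P) ^+ k)`_n|
      <= (D ^+ m) ^+ n * (1 + `|(poly_iter psi m).[x]|) ^+ k.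
Proof.
move=> /majorized_poly_iter[D D1 HD]; exists D => // m x k n.
have D0 : 0 < D by exact: lt_le_trans D1.
have r0 : 0 <= D ^- m by rewrite invr_ge0 exprn_ge0// ltW.
have := majorized_coef r0 n (majorizedXn r0 k (HD m x)).
by rewrite exprVn ler_pdivrMr ?exprn_gt0// mulrC.
Qed.

(** Growth is at least quadratic; the threshold makes (1 + |y|)^2 / K at least (|E| + 1)(1 +
    |y|). *)
Lemma horner_expanding psi E : (2 < size psi)%N ->
  exists2 B, 1 <= B & forall y, B <= `|y| -> E * `|y| <= `|psi.[y]|.
Proof.
move=> psi_gt2; have [K K1 Kp] := @expr_le_horner _ psi (ltnW (ltnW psi_gt2)).
have K0 : 0 < K by exact: lt_le_trans K1.
exists (K * (`|E| + 1)).
  by rewrite mulr_ege1// lerDr.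
move=> y By.
have z1 : 1 <= 1 + `|y| by rewrite lerDl.
have : (1 + `|y|) ^+ 2 <= K * (1 + `|psi.[y]|).
  by apply: le_trans (Kp y); rewrite ler_weXn2l// -ltnS prednK// ltnW// ltnW.
rewrite -ler_pdivrMl// => h.
have : (`|E| + 1) * (1 + `|y|) <= K^-1 * (1 + `|y|) ^+ 2.
  rewrite expr2 mulrA ler_wpM2r ?(le_trans ler01)//.
  by rewrite ler_pdivlMl// (le_trans By)// lerDr.
have : E * `|y| <= `|E| * `|y| by rewrite ler_wpM2r// ler_norm.
by have := normr_ge0 E; have := normr_ge0 y; lra.
Qed.

(** Starting outside [-B, B] the modulus never decreases along the orbit; starting inside, 1 + |x|
    is at most 1 + B. *)
Lemma le_norm_poly_iter psi : (2 < size psi)%N ->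
  exists2 C, 1 <= C & forall m x, 1 + `|x| <= C * (1 + `|(poly_iter psi m).[x]|).
Proof.
move=> /(horner_expanding 1)[B B1 HB].
have B0 : 0 <= B by exact: le_trans B1.
exists (1 + B); first by rewrite lerDl.
move=> m x; have [xB|Bx] := leP `|x| B.
  apply: (@le_trans _ _ (1 + B)); first by rewrite lerD2l.
  by rewrite ler_peMr ?lerDl ?addr_ge0.
have : `|x| <= `|(poly_iter psi m).[x]|.
  elim: m => [|m IH]; first by rewrite /= hornerX.
  rewrite horner_poly_iterS (le_trans IH)// -[leLHS]mul1r HB//.
  by rewrite (le_trans _ IH)// ltW.
by move=> h; rewrite -[leLHS]mul1r ler_pM ?addr_ge0 ?lerD2l// lerDl.
Qed.

End Iterates.

(** * Bell polynomials and Taylor coefficients of powers *)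

Section Bell.
Variable R : comNzRingType.
Implicit Types p : {poly R}.

(* k! times the partial Bell polynomial B_(n,k) in the derivatives of p. *)
Definition bell p n k : {poly R} :=
  \sum_(i < k.+1) (- p) ^+ (k - i) * (p ^+ i)^`(n) *+ 'C(k, i).

Lemma bell0 p k : bell p 0 k = (k == 0%N)%:R.
Proof.
transitivity ((- p + p) ^+ k); first by rewrite exprDn.
by rewrite addNr expr0n.
Qed.

Lemma bellS0 p n : bell p n.+1 0 = (bell p n 0)^`().
Proof. by rewrite /bell !big_ord1 !expr0 !mul1r !mulr1n derivnS. Qed.

(** By the product rule, the terms where (-p)^(k+1-i) is differentiated sum to -(k+1) p'
    [bell p n k], since (k+1-i) C(k+1,i) = (k+1) C(k,i); the last summand on the right cancels
    them. *)
Lemma bellSS p n k :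
  bell p n.+1 k.+1 = (bell p n k.+1)^`() + p^`() * bell p n k *+ k.+1.
Proof.
rewrite /bell raddf_sum/= [X in _ = X + _](eq_bigr (fun i : 'I_k.+2 =>
  ((- p) ^+ (k.+1 - i))^`() * (p ^+ i)^`(n) *+ 'C(k.+1, i) +
  (- p) ^+ (k.+1 - i) * (p ^+ i)^`(n.+1) *+ 'C(k.+1, i))); last first.
  by move=> i _; rewrite derivMn derivM mulrnDl derivnS.
rewrite big_split/= -addrA [RHS]addrC -addrA -[LHS]addr0; congr (_ + _).
apply/esym; rewrite [X in _ + X]big_ord_recr /= subnn expr0 (derivC 1) mul0r mul0rn addr0.
rewrite mulr_sumr -sumrMnl -big_split big1//= => i _.
have ik : (i <= k)%N by rewrite -ltnS.
have := mul_bin_down k.+1 i; rewrite subSn//= => e.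
rewrite deriv_exp derivN /= !mulNr mulrnAl mulNr -mulrnA mulrnAr -mulrnA.
by rewrite [('C(k, i) * _)%N]mulnC e mulrA mulNrn addrN.
Qed.

Lemma bell_gt p n k : (n < k)%N -> bell p n k = 0.
Proof.
elim: n k => [|n IH] [|k]//; first by rewrite bell0.
by move=> nk; rewrite bellSS !IH// 1?ltnW// raddf0 mulr0 mul0rn addr0.
Qed.

Lemma coef_comp_XaddC p (x : R) n : (p \Po ('X + x%:P))`_n = p^`N(n).[x].
Proof.
rewrite /comp_poly addrC nderiv_taylor; last exact: commr_polyX.
rewrite size_map_polyC (eq_bigr (fun i : 'I__ => p^`N(i).[x] *: 'X^i)); last first.
  by move=> i _; rewrite nderivn_map horner_map/= mul_polyC.
rewrite -(poly_def _ (fun i => p^`N(i).[x])) coef_poly; case: ltnP => // pn.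
by rewrite nderivn_poly0// horner0.
Qed.

(** With p(x) frozen as a constant, the binomial sum is the n-th derivative at x of (p - p(x))^k.
    This turns the Taylor coefficient bounds into bounds for Bell polynomials. *)
Lemma horner_bell p (x : R) n k :
  (bell p n k).[x] = ((p \Po ('X + x%:P) - p.[x]%:P) ^+ k)`_n *+ n`!.
Proof.
rewrite addrC exprDn coef_sum -sumrMnl /bell horner_sum; apply: eq_bigr => i _.
rewrite coefMn hornerMn hornerM mulrnAC -polyCN -polyC_exp coefCM horner_exp hornerN.
congr (_ *+ _); rewrite -mulrnAr; congr (_ * _).
by rewrite nderivn_def hornerMn -coef_comp_XaddC rmorphXn.
Qed.

End Bell.

(** * Uniform escape of orbits in the absence of fixed points *)

Section IterateGrowth.
Variable R : realType.
Implicit Types (psi : {poly R}) (x : R).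

Lemma poly_sign_const psi : (forall x, psi.[x] != 0) ->
  exists s : bool, forall x, 0 < (-1) ^+ s * psi.[x].
Proof.
move=> nz; exists (psi.[0] < 0)%R => x; rewrite lt_neqAle eq_sym.
rewrite mulf_neq0 ?signr_eq0// leNgt; apply/negP => sx.
set q : {poly R} := (-1) ^+ (psi.[0] < 0)%R *: psi.
have q0 : 0 <= q.[0].
  rewrite hornerZ; case: ltP => [/ltW h|h]; last by rewrite expr0 mul1r.
  by rewrite expr1 mulN1r oppr_ge0.
have qx : q.[x] <= 0 by rewrite hornerZ ltW.
have [y /rootP] : exists y, root q y.
  (* [poly_ivt] needs a value <= 0 at the left end and >= 0 at the right end, so for x > 0 it is
     applied to -q. *)
  have [x0|x0] := leP x 0.
    have [y _ qy] : exists2 y, x <= y <= 0 & root q y.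
      by apply: poly_ivt => //; rewrite qx q0.
    by exists y.
  have [y _ qy] : exists2 y, 0 <= y <= x & root (- q) y.
    apply: poly_ivt; first exact: ltW.
    by rewrite !hornerN oppr_le0 oppr_ge0 q0.
  by exists y; rewrite -[q]opprK rootN.
by rewrite hornerZ; apply/eqP; rewrite mulf_neq0 ?signr_eq0.
Qed.

(** On the compact interval [-B, B] the difference psi(t) - t has constant sign and modulus at least
    some d > 0, so every orbit leaves within N steps once N d > 2B. Outside, each step multiplies
    the modulus by at least E. Neither N nor B depends on x. *)
Lemma poly_iter_growth psi E : (2 < size psi)%N -> (forall x, psi.[x] != x) ->
  1 <= E ->
  exists2 C, 1 <= C & forall m x, E ^+ m <= C * (1 + `|(poly_iter psi m).[x]|).
Proof.
move=> psi_gt2 fixpsi E1; have [B B1 HB] := horner_expanding E psi_gt2.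
have B0 : 0 <= B by exact: le_trans B1.
have E0 : 0 < E by exact: lt_le_trans E1.
have [s sq] : exists s : bool, forall x, 0 < (-1) ^+ s * (psi.[x] - x).
  have [|s sq] := @poly_sign_const (psi - 'X).
    by move=> x; rewrite !hornerE subr_eq0.
  by exists s => x; have := sq x; rewrite !hornerE.
have [c _ cmin] : exists2 c, c \in `[- B, B] &
    forall t, t \in `[- B, B] -> (-1) ^+ s * (psi.[c] - c) <= (-1) ^+ s * (psi.[t] - t).
  apply: (@EVT_min _ (fun t => (-1) ^+ s * (psi.[t] - t))).
    by rewrite (le_trans _ B0)// oppr_le0.
  apply: continuous_subspaceT => t.
  rewrite (_ : (fun _ => _) = horner ((-1) ^+ s *: (psi - 'X))); last first.
    by apply/funext => u; rewrite !hornerE.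
  exact: continuous_horner.
set d := (-1) ^+ s * (psi.[c] - c) in cmin; have d0 : 0 < d by exact: sq.
have [N dN] : exists N : nat, 2 * B < N%:R * d.
  exists (Num.bound (2 * B / d)); rewrite -ltr_pdivrMr//; apply: archi_boundP.
  by apply: divr_ge0; [exact: mulr_ge0|exact: ltW].
have Bstay x m k : B <= `|(poly_iter psi m).[x]| ->
    E ^+ k * B <= `|(poly_iter psi (k + m)).[x]|.
  move=> Bm; elim: k => [|k IH]; first by rewrite expr0 mul1r.
  rewrite addSn horner_poly_iterS exprS -mulrA.
  apply: (@le_trans _ _ (E * `|(poly_iter psi (k + m)).[x]|)).
    by rewrite ler_pM2l.
  by apply: HB; apply: le_trans IH; rewrite ler_peMl// exprn_ege1.
(* The outside region is never left again, so an orbit inside at time N was inside throughout; its N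
   displacements of one sign then add up to at least N d, while both ends lie in an interval of
   length 2B. *)
have escape x : B <= `|(poly_iter psi N).[x]|.
  rewrite leNgt; apply/negP => ltB.
  have allB j : (j <= N)%N -> `|(poly_iter psi j).[x]| < B.
    move=> jN; rewrite ltNge; apply/negP => /Bstay-/(_ (N - j)%N).
    rewrite subnK// leNgt (lt_le_trans ltB)// ler_peMl// exprn_ege1//.
  have : forall j, (j <= N)%N -> j%:R * d <= (-1) ^+ s * ((poly_iter psi j).[x] - x).
    elim=> [_|j IH jN]; first by rewrite /= hornerX subrr mulr0 mul0r.
    rewrite horner_poly_iterS -natr1 mulrDl mul1r.
    rewrite -[psi.[_] - x](subrKA (poly_iter psi j).[x]) addrC mulrDr lerD//.
      rewrite cmin// in_itv/= -ler_norml ltW// allB// ltnW//.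
    by rewrite IH// ltnW.
  move=> /(_ N (leqnn N)); apply/negP; rewrite -ltNge; apply: le_lt_trans dN.
  apply: (le_trans (ler_norm _)); rewrite normrM normr_sign mul1r.
  apply: (le_trans (ler_normB _ _)).
  have := allB 0%N (leq0n _); rewrite /= hornerX => xB.
  by rewrite mulr_natl mulr2n; apply: lerD; exact: ltW.
(* E^N pays for the first N steps, in which no growth is known. *)
exists (E ^+ N); first by rewrite exprn_ege1.
move=> m x; have [mN|Nm] := leqP m N.
  apply: (@le_trans _ _ (E ^+ N)); first by rewrite ler_weXn2l.
  by rewrite ler_peMr ?lerDl// ltW// exprn_gt0.
rewrite -(subnK (ltnW Nm)) addnC exprD ler_pM2l ?exprn_gt0//.
rewrite addnC (le_trans _ (le_trans (Bstay _ _ (m - N)%N (escape x)) _))//.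
  by rewrite ler_peMr ?exprn_ge0// ltW.
by rewrite lerDr.
Qed.

End IterateGrowth.

(** * The Faa di Bruno formula for a polynomial inner function *)

Section CompositionDerivatives.
Variable R : realType.
Implicit Types (h : R -> R) (p : {poly R}) (x : R).

Definition faa_di_bruno h p n x :=
  \sum_(k < n.+1) derive1n k h p.[x] * ((bell p n k).[x] / k`!%:R).

(** The right side is the termwise derivative of the n-th sum; the match is [bellSS] together with
    (k+1)/(k+1)! = 1/k!. *)
Lemma faa_di_brunoS h p n x :
  faa_di_bruno h p n.+1 x =
  \sum_(k < n.+1) (derive1n k h p.[x] * ((bell p n k)^`().[x] / k`!%:R) +
    derive1n k.+1 h p.[x] * p^`().[x] * ((bell p n k).[x] / k`!%:R)).
Proof.
rewrite /faa_di_bruno big_ord_recl bellS0.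
rewrite (eq_bigr (fun k : 'I_n.+1 =>
  derive1n k.+1 h p.[x] * ((bell p n k.+1)^`().[x] / (k.+1)`!%:R) +
  derive1n k.+1 h p.[x] * p^`().[x] * ((bell p n k).[x] / k`!%:R))); last first.
  move=> k _; rewrite /= /bump leq0n add1n bellSS hornerD hornerMn hornerM -mulrA -mulrDr.
  congr (_ * _); rewrite mulrDl; congr (_ + _).
  have k1 : k.+1%:R != 0 :> R by rewrite pnatr_eq0.
  have kf : k`!%:R != 0 :> R by rewrite pnatr_eq0 -lt0n fact_gt0.
  rewrite factS natrM -mulr_natr; move: k.+1%:R k`!%:R k1 kf => u v u0 v0.
  by field; rewrite u0 v0.
rewrite !big_split addrA; congr (_ + _).
rewrite big_ord_recr /= (@bell_gt _ p n n.+1)// deriv0 horner0 mul0r mulr0 addr0.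
rewrite [RHS]big_ord_recl; congr (_ + _).
Qed.

Lemma is_derive_faa_di_bruno h p n x :
  (forall k y, derivable (derive1n k h) y 1) ->
  is_derive x 1 (faa_di_bruno h p n) (faa_di_bruno h p n.+1 x).
Proof.
move=> sh.
rewrite (_ : faa_di_bruno h p n = \sum_(k < n.+1)
    (derive1n k h \o horner p) * horner ((k`!%:R)^-1 *: bell p n k)); last first.
  apply/funext => y; rewrite /faa_di_bruno fct_sumE; apply: eq_bigr => k _.
  by rewrite /= /GRing.mul/= hornerZ [_^-1 * _]mulrC.
rewrite faa_di_brunoS; apply: is_derive_sum => k.
have dk : is_derive p.[x] 1 (derive1n k h) (derive1n k.+1 h p.[x]).
  by apply: DeriveDef => //; rewrite derive1nS derive1E.
apply: (is_derive_eq (is_deriveM (is_derive1_comp dk (is_derive_poly p x))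
  (is_derive_poly _ x))).
rewrite derivZ !hornerZ /= addrC /GRing.scale/= addrC; congr (_ + _).
  by rewrite [_^-1 * _]mulrC.
by rewrite mulrC [_^-1 * _]mulrC.
Qed.

Lemma derive1n_comp_poly h p :
  (forall k y, derivable (derive1n k h) y 1) -> forall n,
  (forall x, derive1n n (h \o horner p) x = faa_di_bruno h p n x) /\
  (forall x, derivable (derive1n n (h \o horner p)) x 1).
Proof.
move=> sh n.
suff E m : derive1n m (h \o horner p) = faa_di_bruno h p m.
  by rewrite E; split=> // x; have [] := is_derive_faa_di_bruno p n x sh.
elim: m => [|m IH].
  apply/funext => x; rewrite /faa_di_bruno big_ord1 bell0 hornerC/= divr1 mulr1//.
rewrite derive1nS IH; apply/funext => x; rewrite derive1E.
by have [_ ->] := is_derive_faa_di_bruno p m x sh.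
Qed.

Lemma normc_ge0 (z : R[i]) : 0 <= normc z.
Proof. by case: z => u v; rewrite sqrtr_ge0. Qed.

Lemma normcZ (u v c : R) : normc ((u * c) +i* (v * c)) = normc (u +i* v) * `|c|.
Proof. by rewrite /normc !exprMn -mulrDl sqrtrM ?addr_ge0 ?sqr_ge0// sqrtr_sqr. Qed.

Lemma normc_comp_poly (f : R -> R[i]) p : smooth f ->
  smooth (f \o horner p) /\ forall n x,
  normc (cderiven n (f \o horner p) x) <=
    \sum_(k < n.+1) normc (cderiven k f p.[x]) * `|(bell p n k).[x]| / k`!%:R.
Proof.
move=> sf.
have DR := derive1n_comp_poly p (fun n x => (sf n x).1).
have DI := derive1n_comp_poly p (fun n x => (sf n x).2).
split=> n x; first by split; [exact: (DR n).2|exact: (DI n).2].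
rewrite /cderiven ((DR n).1 x) ((DI n).1 x) /faa_di_bruno.
(* The real and imaginary sums carry the same real weights, so each pair of terms is a complex
   number scaled by a real one. *)
elim/big_ind3 : _ => [|? ? ? ? ? ? h h'|k _].
- by rewrite /normc expr0n/= addr0 sqrtr0.
- by apply: le_trans (lerD h h'); exact: (le_normcD (_ +i* _) (_ +i* _)).
- by rewrite normcZ normrM normfV mulrA (ger0_norm (ler0n _ _)).
Qed.

End CompositionDerivatives.

(** * The Young conjugate of a weight *)

Section YoungConjugate.
Variables (R : realType) (omega : R -> R).
Hypothesis w_omega : is_weight omega.
Local Notation young := (young_conjugate omega).

Lemma weight_expR_ge0 t : 0 <= omega (expR t).
Proof. exact: (weight_ge0 w_omega (expR_ge0 t)). Qed.

Lemma young_le s M :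
  (forall t, 0 <= t -> s * t - omega (expR t) <= M) -> young s <= M.
Proof.
move=> sM; apply: ge_sup; first by exists (s * 0 - omega (expR 0)); exists 0 => /=.
by move=> _ [t t0 <-]; exact: sM.
Qed.

(** The content is that the supremum is finite: condition (gamma) with eps = 1/(|s| + 1) gives (|s|
    + 1) u <= omega(e^u) for e^u > T, and otherwise u <= |T|. *)
Lemma young_ge s t : 0 <= t -> s * t - omega (expR t) <= young s.
Proof.
move=> t0; apply: ub_le_sup; last by exists t.
have e0 : 0 < (`|s| + 1)^-1 by rewrite invr_gt0 ltr_wpDl.
have [T [_ HT]] := weight_gamma w_omega e0.
exists (`|s| * `|T|) => _ [u /= u0 <-].
have su : s * u <= `|s| * u by rewrite ler_wpM2r// ler_norm.
have [Tu|uT] := ltP T (expR u).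
  have := HT _ Tu.
  rewrite [`|omega _|]ger0_norm ?weight_expR_ge0// ler_pdivlMl ?ltr_wpDl// => h.
  have : ln (expR u) <= `|ln (1 + expR u ^+ 2)|.
    apply: le_trans (ler_norm _).
    rewrite ler_ln ?posrE ?expR_gt0 ?addr_gt0 ?exprn_gt0 ?expR_gt0//.
    by rewrite -subr_ge0; have := sqr_ge0 (expR u - 2^-1); lra.
  rewrite expRK => h'.
  have : (`|s| + 1) * u <= omega (expR u).
    by apply: le_trans h; rewrite ler_wpM2l// addr_ge0.
  by have := mulr_ge0 (normr_ge0 s) (normr_ge0 T); lra.
have : `|s| * u <= `|s| * `|T|.
  rewrite ler_wpM2l//; have := expR_ge1Dx u; have := ler_norm T; lra.
by have := weight_expR_ge0 u; lra.
Qed.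

Lemma le_young s t : s <= t -> young s <= young t.
Proof.
move=> st; apply: young_le => u u0; apply: le_trans (young_ge t u0).
by rewrite lerB// ler_wpM2r.
Qed.

(** Since omega >= 0, scaling gives young(r) <= r/(s+t) young(s+t) for 0 <= r <= s+t; add the cases
    r = s and r = t. *)
Lemma young_superadditive s t : 0 <= s -> 0 <= t ->
  young s + young t <= young (s + t).
Proof.
move=> s0 t0; have [st0|st0] := ltP 0 (s + t); last first.
  have -> : s = 0 by lra.
  have -> : t = 0 by lra.
  rewrite addr0 gerDl; apply: young_le => u u0.
  by rewrite mul0r sub0r oppr_le0 weight_expR_ge0.
have scale r : 0 <= r -> r <= s + t -> young r <= r / (s + t) * young (s + t).
  move=> r0 rst; apply: young_le => u u0.
  have h := ler_wpM2l (divr_ge0 r0 (ltW st0)) (young_ge (s + t) u0).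
  apply: le_trans h; rewrite mulrBr mulrA divfK ?gt_eqF// lerB// ler_piMl ?weight_expR_ge0//.
  by rewrite ler_pdivrMr// mul1r.
have := scale s s0; have := scale t t0; rewrite lerDl lerDr => /(_ s0) ht /(_ t0) hs.
apply: (le_trans (lerD hs ht)).
by rewrite -mulrDl -mulrDl divff ?mul1r// gt_eqF.
Qed.

(** Substitute t = a u in the supremum; this is where passing from omega to sigma multiplies the
    available order by a. *)
Lemma young_powR (a s : R) : 0 < a ->
  young_conjugate (fun t => omega (t `^ a^-1)) s = young (a * s).
Proof.
move=> a0; rewrite /young_conjugate; congr (sup _); apply/seteqP; split => _ [t /= t0 <-].
  exists (t / a); first by rewrite /= divr_ge0// ltW.
  by rewrite -expRM; congr (_ - _); field; rewrite gt_eqF.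
exists (a * t); first by rewrite /= mulr_ge0// ltW.
by rewrite -expRM mulrAC divff ?gt_eqF// mul1r mulrA [s * a]mulrC.
Qed.

End YoungConjugate.

(** * Absorbing factorials and geometric factors into the conjugate *)

Lemma binomial_le_expn n k : ('C(n, k) <= 2 ^ n)%N.
Proof.
elim: n k => [|n IH] [|k]; rewrite ?bin0 ?bin0n ?expn_gt0//.
by rewrite binS expnS mul2n -addnn leq_add.
Qed.

Lemma fact_le_expn n : (n`! <= n ^ n)%N.
Proof.
elim: n => // n IH; rewrite factS expnS leq_mul//.
by rewrite (leq_trans IH)//; case: n {IH} => // n; rewrite leq_exp2r.
Qed.

Section ScaledConjugate.
Variables (R : realType) (omega : R -> R) (l : R).
Hypotheses (s_omega : subadditive_weight omega) (l0 : 0 < l).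
Let w_omega : is_weight omega := s_omega.1.

(** The Young conjugate of l phi_omega, which is the exponent in the seminorm of index [l]. *)
Definition scaled_young (s : R) := l * young_conjugate omega (s / l).
Local Notation Phi := scaled_young.

Lemma scaled_young_ge s t : 0 <= t -> s * t - l * omega (expR t) <= Phi s.
Proof.
move=> t0; have := ler_wpM2l (ltW l0) (young_ge w_omega (s / l) t0).
by rewrite mulrBr mulrA mulrCA divff ?mulr1// gt_eqF.
Qed.

Lemma le_scaled_young s t : s <= t -> Phi s <= Phi t.
Proof.
by move=> st; rewrite ler_pM2l// le_young// ler_pM2r ?invr_gt0.
Qed.

Lemma scaled_young_superadditive s t : 0 <= s -> 0 <= t ->
  Phi s + Phi t <= Phi (s + t).
Proof.
move=> s0 t0; rewrite -mulrDr ler_pM2l// [(s + t) / l]mulrDl.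
by rewrite young_superadditive// divr_ge0// ltW.
Qed.

(** Test the supremum at t = ln n, with n! <= n^n and omega(n) <= n omega(1) by subadditivity. The
    extra power of [A] covers n = 0, where Phi(0) may be negative. *)
Lemma fact_le_expR_young :
  exists2 A, 1 <= A & forall n, n`!%:R <= A ^+ n.+1 * expR (Phi n%:R).
Proof.
have w1 : 0 <= omega 1 by exact: weight_ge0.
have wn n : omega n.+1%:R <= n.+1%:R * omega 1.
  elim: n => [|n IH]; first by rewrite mul1r.
  rewrite -[n.+2%:R]natr1; apply: (le_trans (s_omega.2 _ _ _ _)) => //.
  by rewrite mulrDl mul1r lerD2r.
exists (expR (l * omega 1)); first by rewrite -[leLHS]expR0 ler_expR mulr_ge0// ltW.
case=> [|n].
  rewrite expr1 -expRD -[leLHS]expR0 ler_expR.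
  by have := scaled_young_ge 0 (lexx 0); rewrite expR0 mul0r; lra.
apply: (@le_trans _ _ (n.+1%:R ^+ n.+1)); first by rewrite -natrX ler_nat fact_le_expn.
have n0 : n.+1%:R \is @Num.pos R by rewrite posrE.
rewrite -[X in X ^+ _ <= _](lnK n0) -expRM_natl -expRM_natl -expRD ler_expR.
have := scaled_young_ge n.+1%:R (ln_ge0 (_ : 1 <= n.+1%:R)); rewrite lnK// ler1n => /(_ isT).
have : l * omega n.+1%:R <= l * (n.+1%:R * omega 1) by rewrite ler_pM2l.
have : 0 <= l * omega 1 by rewrite mulr_ge0// ltW.
by rewrite -[n.+2%:R]natr1 mulrDl mul1r mulrCA; lra.
Qed.

(** Test the supremum at t = ln B / eta: a geometric factor costs only eta n orders. *)
Lemma expr_le_expR_young B eta : 1 <= B -> 0 < eta ->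
  exists2 C, 1 <= C & forall n, B ^+ n <= C * expR (Phi (eta * n%:R)).
Proof.
move=> B1 eta0; have B0 : 0 < B by exact: lt_le_trans B1.
have t0 : 0 <= ln B / eta by rewrite divr_ge0 ?ln_ge0// ltW.
exists (expR (l * omega (expR (ln B / eta)))).
  rewrite -[leLHS]expR0 ler_expR; apply: mulr_ge0; first exact: ltW.
  exact: (weight_expR_ge0 w_omega).
move=> n; have BK : B \is Num.pos by rewrite posrE.
rewrite -[X in X ^+ _](lnK BK) -expRM_natl -expRD ler_expR.
have := scaled_young_ge (eta * n%:R) t0.
rewrite (_ : eta * n%:R * (ln B / eta) = n%:R * ln B); first lra.
by field; rewrite gt_eqF.
Qed.

End ScaledConjugate.

(** Superadditivity adds up all the orders, and a = 2 + 3 eta leaves room for them. [N] comes before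
    [B] because the base to be absorbed will be built from growth constants depending on [N]. *)
Lemma expR_young_absorb (R : realType) (omega : R -> R) (l a : R) :
  subadditive_weight omega -> 0 < l -> 2 < a ->
  exists2 N, (0 < N)%N & forall B, 1 <= B -> exists2 C, 0 <= C &
    forall n k q, (k <= n)%N ->
      B ^+ (n + q) * ((n - k)`!%:R *
        expR (scaled_young omega l (k + (q + k + n %/ N).+2)%:R))
      <= C * expR (scaled_young omega l (a * (n + q)%:R)).
Proof.
move=> s_omega l0 a2; set eta := (a - 2) / 3.
have eta0 : 0 < eta by rewrite divr_gt0// subr_gt0.
have aE : a = 2 + 3 * eta by rewrite /eta; field.
set N := (Num.bound eta^-1).+1; exists N => // B B1.
have B0 : 0 <= B by exact: le_trans B1.
have divN n : (n %/ N)%:R <= eta * n%:R.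
  have : eta^-1 <= N%:R.
    apply/ltW/(@lt_trans _ _ (Num.bound eta^-1)%:R); last by rewrite ltr_nat.
    by apply: archi_boundP; rewrite invr_ge0 ltW.
  rewrite -(ler_pM2l eta0) divff ?gt_eqF// => h.
  have : ((n %/ N) * N)%:R <= n%:R :> R by rewrite ler_nat leq_trunc_div.
  rewrite natrM -(ler_pM2l eta0) mulrCA => h'; apply: le_trans h'.
  by rewrite ler_peMr.
have [A A1 HA] := fact_le_expR_young s_omega l0.
have A0 : 0 <= A by exact: le_trans A1.
(* The base B A also absorbs the geometric factor of the factorial estimate. *)
have [C1 C11 HC1] := expr_le_expR_young s_omega l0 (mulr_ege1 B1 A1) eta0.
have C10 : 0 <= C1 by exact: le_trans C11.
set Phi := scaled_young omega l in HA HC1 *.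
(* [S] bounds the total order when eta j < 2, and [Z] is the price of that bounded range. *)
set S := 6 + 4 / eta; set Z := expR (Phi S - Phi 0).
exists (A * C1 * (1 + Z)); first by rewrite !mulr_ge0// addr_ge0// expR_ge0.
move=> n k q kn; set j := (n + q)%N; set r := (k + _)%:R.
have h1 : B ^+ j * (n - k)`!%:R <= A * C1 * expR (Phi (eta * j%:R) + Phi (n - k)%:R).
  apply: (@le_trans _ _ (B ^+ j * (A * A ^+ j * expR (Phi (n - k)%:R)))).
    rewrite ler_wpM2l ?exprn_ge0//; apply: (le_trans (HA _)).
    rewrite ler_wpM2r ?expR_ge0// exprS ler_wpM2l// ler_weXn2l//.
    by rewrite (leq_trans (leq_subr _ _))// leq_addr.
  rewrite expRD !mulrA ler_wpM2r ?expR_ge0// mulrAC -exprMn mulrC -mulrA.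
  by rewrite ler_wpM2l.
set s := eta * j%:R + (n - k)%:R + r.
have h2 : B ^+ j * ((n - k)`!%:R * expR (Phi r)) <= A * C1 * expR (Phi s).
  rewrite mulrA; apply: (@le_trans _ _ (A * C1 *
      expR (Phi (eta * j%:R) + Phi (n - k)%:R) * expR (Phi r))).
    by rewrite ler_wpM2r ?expR_ge0.
  rewrite -mulrA -expRD; apply: ler_wpM2l; first exact: mulr_ge0.
  rewrite ler_expR.
  have e0 : 0 <= eta * j%:R by rewrite mulr_ge0// ltW.
  have enk0 := addr_ge0 e0 (ler0n R (n - k)).
  apply: le_trans (scaled_young_superadditive s_omega l0 enk0 (ler0n _ _)).
  by rewrite lerD2r; exact: scaled_young_superadditive.
apply: (le_trans h2); rewrite -[leRHS]mulrA ler_wpM2l ?mulr_ge0//.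
have sle : s <= 2 * j%:R + 2 * (eta * j%:R) + 2.
  rewrite /s /r natrB// -addn2 addnA !natrD /j ?natrD ?mulrDr.
  have : (k%:R : R) <= n%:R by rewrite ler_nat.
  have := ler0n R q; have := mulr_ge0 (ltW eta0) (ler0n R q); have := divN n.
  by lra.
(* Of the 3 eta j available, 2 eta j are spent; the last eta j absorbs the additive 2 as soon as it
   is at least 2. *)
have [ge2|lt2] := leP 2 (eta * j%:R).
  rewrite mulrDl mul1r; apply: (@le_trans _ _ (expR (Phi (a * j%:R)))); last first.
    by rewrite lerDl mulr_ge0 ?expR_ge0.
  by rewrite ler_expR le_scaled_young// (le_trans sle)// aE; lra.
rewrite mulrDl mul1r; apply: (@le_trans _ _ (Z * expR (Phi (a * j%:R)))); last first.
  by rewrite lerDr expR_ge0.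
have aj0 : Phi 0 <= Phi (a * j%:R).
  by apply: le_scaled_young => //; rewrite mulr_ge0// (le_trans _ (ltW a2)).
have sS : Phi s <= Phi S.
  apply: le_scaled_young => //; apply: (le_trans sle).
  have : j%:R <= 2 / eta by rewrite ler_pdivlMr// mulrC ltW.
  by rewrite /S; lra.
by rewrite -expRD ler_expR; lra.
Qed.

(** * Derivative estimates for compositions with iterates *)

Section IterateEstimates.
Variables (R : realType) (psi : {poly R}) (mu : R[i]).
Hypotheses (psi_gt2 : (2 < size psi)%N) (fixpsi : forall x, psi.[x] != x).
Hypothesis mu0 : mu != 0.

Let nmu0 : 0 < normc mu.
Proof.
rewrite lt_neqAle normc_ge0 andbT eq_sym; apply: contra mu0 => /eqP h.
by rewrite (eq0_normc h).
Qed.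

Let P m := poly_iter psi m.

(** Faa di Bruno with the Cauchy estimate for the Bell polynomials, where n!/k! = C(n,k) (n-k)! is
    at most 2^n (n-k)!. *)
Lemma normc_comp_poly_iter : exists2 D, 1 <= D & forall f m x n, smooth f ->
  normc (cderiven n (f \o horner (P m)) x) <= \sum_(k < n.+1)
    2 ^+ n * (n - k)`!%:R * (D ^+ m) ^+ n *
    ((1 + `|(P m).[x]|) ^+ k * normc (cderiven k f (P m).[x])).
Proof.
have [D D1 HD] := @norm_coef_poly_iterXn R psi (ltnW psi_gt2).
exists D => // f m x n sf; have [_ /(_ n x) h] := normc_comp_poly (P m) sf.
apply: (le_trans h); apply: ler_sum => k _; rewrite horner_bell.
set c := _`_n; have : `|c| <= _ := HD m x k n.
move: c (1 + `|_|) (normc_ge0 (cderiven k f (P m).[x])) => c w.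
move: (normc _) (D ^+ m) => u d u0 hc.
have kf : 0 < k`!%:R :> R by rewrite ltr0n fact_gt0.
rewrite normrMn -[_ *+ n`!]mulr_natr ler_pdivrMr//.
have nk : n`!%:R <= 2 ^+ n * (n - k)`!%:R * k`!%:R :> R.
  have kn : (k <= n)%N by rewrite -ltnS.
  rewrite -natrX -!natrM ler_nat -(bin_fact kn) -[leqRHS]mulnA.
  by rewrite [((n - k)`! * _)%N]mulnC leq_mul// binomial_le_expn.
apply: (@le_trans _ _ (u * ((d ^+ n * w ^+ k) * (2 ^+ n * (n - k)`!%:R * k`!%:R)))).
  by rewrite ler_wpM2l// ler_pM.
by rewrite le_eqVlt; apply/orP; left; apply/eqP; ring.
Qed.

Lemma normc_expr_le : exists2 E, 1 <= E & forall m,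
  1 <= (normc mu / 2) ^+ m * E ^+ m.
Proof.
exists (1 + 2 / normc mu); first by rewrite lerDl divr_ge0// ltW.
move=> m; rewrite -exprMn exprn_ege1// mulrDr mulr1 mulrA divfK// divff ?gt_eqF//.
by rewrite lerDr divr_ge0// ltW.
Qed.

(** Serves to make the remainder of the iterated resolvent equation vanish, so [Y] may depend on f,
    n and x. One extra power of 1 + |psi_m(x)| in the Schwartz bound beats (D^n E)^m, which pays for
    D^(mn) and produces (|mu|/2)^m. *)
Lemma schwartz_comp_poly_iter f n x : schwartz f -> exists Y, forall m,
  normc (cderiven n (f \o horner (P m)) x) <= Y * (normc mu / 2) ^+ m.
Proof.
move=> [sf bf]; have [D D1 HD] := normc_comp_poly_iter.
have [E E1 HE] := normc_expr_le.
have [C C1 HC] := poly_iter_growth psi_gt2 fixpsi (mulr_ege1 (exprn_ege1 n D1) E1).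
have C0 : 0 <= C by exact: le_trans C1.
have [G HG] : exists G : nat -> R, forall k y,
    (1 + `|y|) ^+ k.+1 * normc (cderiven k f y) <= G k.
  by have /choice[G HG] := fun k => bf k k.+1; exists G.
exists (\sum_(k < n.+1) 2 ^+ n * (n - k)`!%:R * (C * G k)) => m.
apply: (le_trans (HD f m x n sf)); rewrite mulr_suml; apply: ler_sum => k _.
set w := 1 + `|_|; have w0 : 0 <= w by rewrite addr_ge0.
rewrite -!mulrA ler_wpM2l ?exprn_ge0// ler_wpM2l//.
set z := (normc mu / 2) ^+ m.
have z0 : 0 <= z by rewrite exprn_ge0// divr_ge0// ltW.
have Dz : (D ^+ m) ^+ n <= z * (C * w).
  have := HC m x; rewrite -/w exprMn -!exprM mulnC exprM => h.
  apply: le_trans (ler_wpM2l z0 h); rewrite mulrCA ler_peMr ?HE//.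
  by rewrite -exprM exprn_ge0// (le_trans _ D1).
apply: (@le_trans _ _ (z * (C * w) * (w ^+ k * normc (cderiven k f (P m).[x])))).
  by rewrite ler_wpM2r// mulr_ge0 ?exprn_ge0 ?normc_ge0.
rewrite [leRHS]mulrA [leRHS]mulrC -mulrA ler_wpM2l// -mulrA ler_wpM2l//.
by rewrite mulrA -exprS HG.
Qed.

Variables (omega : R -> R) (l a : R).
Hypotheses (s_omega : subadditive_weight omega) (l0 : 0 < l) (a2 : 2 < a).
Local Notation Phi := (scaled_young omega l).

Lemma gs_comp_poly_iter : exists2 C, 0 <= C & forall f M, smooth f -> 0 <= M ->
  (forall y n q, (1 + `|y|) ^+ q * normc (cderiven n f y) <= M * expR (Phi (n + q)%:R)) ->
  forall m x n q, (1 + `|x|) ^+ q * normc (cderiven n (f \o horner (P m)) x) <=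
    C * (normc mu / 2) ^+ m * (M * expR (Phi (a * (n + q)%:R))).
Proof.
have [D D1 HD] := normc_comp_poly_iter.
have [E E1 HE] := normc_expr_le.
have [N N0 HN] := expR_young_absorb s_omega l0 a2.
(* Growth against D^N bounds D^(mn) by n/N + 1 powers of 1 + |psi_m(x)|; growth against E spends one
   more power on (|mu|/2)^m. *)
have [C1 C11 HC1] := poly_iter_growth psi_gt2 fixpsi (exprn_ege1 N D1).
have [C2 C21 HC2] := poly_iter_growth psi_gt2 fixpsi E1.
have [C3 C31 HC3] := le_norm_poly_iter psi_gt2.
have C10 : 0 <= C1 by exact: le_trans C11.
have C20 : 0 <= C2 by exact: le_trans C21.
have C30 : 0 <= C3 by exact: le_trans C31.
have D0 : 0 <= D by exact: le_trans D1.
have C131 : 1 <= C1 * C3 by exact: mulr_ege1.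
(* The 4 accounts for the 2^n of [normc_comp_poly_iter] and for a spare 2^n used to sum the
   terms. *)
have [C C0 HC] := HN (4 * (C1 * C3)) ltac:(lra).
exists (C1 * C2 * C); first by rewrite !mulr_ge0.
move=> f M sf M0 HM m x n q.
set z := (normc mu / 2) ^+ m.
have z0 : 0 <= z by rewrite exprn_ge0// divr_ge0// ltW.
set X := expR (Phi (a * (n + q)%:R)).
set w := 1 + `|(P m).[x]|; have w1 : 1 <= w by rewrite lerDl.
have w0 : 0 <= w by exact: le_trans w1.
have zw : 1 <= z * (C2 * w) by apply: le_trans (HE m) _; apply: ler_wpM2l => //; exact: HC2.
have Dw : (D ^+ m) ^+ n <= C1 ^+ n.+1 * w ^+ (n %/ N).+1.
  apply: (@le_trans _ _ (((D ^+ N) ^+ m) ^+ (n %/ N).+1)).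
    rewrite -!exprM ler_weXn2l// mulnCA leq_mul//.
    by rewrite mulnC ltnW// ltn_ceil.
  apply: (@le_trans _ _ ((C1 * w) ^+ (n %/ N).+1)).
    by apply: lerXn2r; rewrite ?nnegrE ?exprn_ge0 ?mulr_ge0//; exact: HC1.
  rewrite exprMn ler_wpM2r ?exprn_ge0// ler_weXn2l// ltnS.
  by rewrite leq_div.
have xw : (1 + `|x|) ^+ q <= C3 ^+ q * w ^+ q.
  rewrite -exprMn; apply: lerXn2r; rewrite ?nnegrE ?mulr_ge0 ?addr_ge0//.
  exact: HC3.
(* Each term keeps a factor 2^-n, and n + 1 <= 2^n, so the n + 1 terms together stay below the
   target. *)
have term (k : 'I_n.+1) : (1 + `|x|) ^+ q * (2 ^+ n * (n - k)`!%:R * (D ^+ m) ^+ n *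
    (w ^+ k * normc (cderiven k f (P m).[x]))) <=
    (2 ^+ n)^-1 * (C1 * C2 * C * z * (M * X)).
  set F := normc _; have F0 : 0 <= F by exact: normc_ge0.
  have kn : (k <= n)%N by rewrite -ltnS.
  have two0 : 0 < 2 ^+ n :> R by rewrite exprn_gt0.
  set p := (q + k + n %/ N)%N.
  have hF : w ^+ p.+2 * F <= M * expR (Phi (k + p.+2)%:R) by exact: HM.
  set Fk := (n - k)`!%:R; have Fk0 : 0 <= Fk :> R by exact: ler0n.
  set T := C3 ^+ q * w ^+ q * (2 ^+ n * Fk * (C1 ^+ n.+1 * w ^+ (n %/ N).+1) * (w ^+ k * F)).
  have T0 : 0 <= T by rewrite !mulr_ge0 ?exprn_ge0.
  apply: (@le_trans _ _ T).
    rewrite /T ler_pM ?mulr_ge0 ?exprn_ge0 ?addr_ge0//.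
    by rewrite ler_wpM2r ?mulr_ge0 ?exprn_ge0// ler_wpM2l// mulr_ge0// ltW.
  apply: (le_trans (ler_peMr T0 zw)).
  have -> : T * (z * (C2 * w)) = C1 * C2 * z * (2 ^+ n * (C1 ^+ n * C3 ^+ q)) * Fk *
      (w ^+ p.+2 * F) by rewrite /T /p !exprS !exprD; ring.
  set e := expR _ in hF; have e0 : 0 <= e by exact: expR_ge0.
  have hB : 2 ^+ n * (C1 ^+ n * C3 ^+ q) <= (2 ^+ n)^-1 * (4 * (C1 * C3)) ^+ (n + q).
    rewrite -ler_pdivrMl ?invr_gt0// invrK.
    have -> : 2 ^+ n * (2 ^+ n * (C1 ^+ n * C3 ^+ q)) = 4 ^+ n * (C1 ^+ n * C3 ^+ q).
      by rewrite mulrA -exprMn; congr (_ ^+ _ * _); ring.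
    rewrite !exprMn; apply: ler_pM; rewrite ?mulr_ge0 ?exprn_ge0//.
      by rewrite ler_weXn2l ?leq_addr//; lra.
    by apply: ler_pM; rewrite ?exprn_ge0// ler_weXn2l ?leq_addr ?leq_addl.
  have KK0 : 0 <= C1 * C2 * z by rewrite !mulr_ge0.
  apply: (@le_trans _ _ (C1 * C2 * z *
      ((2 ^+ n)^-1 * (4 * (C1 * C3)) ^+ (n + q)) * Fk * (M * e))).
    have H0 : 0 <= 2 ^+ n * (C1 ^+ n * C3 ^+ q) by rewrite !mulr_ge0 ?exprn_ge0.
    apply: ler_pM => //; first by apply: mulr_ge0 => //; exact: mulr_ge0.
      by apply: mulr_ge0 => //; exact: exprn_ge0.
    by apply: ler_wpM2r => //; apply: ler_wpM2l.
  rewrite [leLHS](_ : _ = (2 ^+ n)^-1 * (C1 * C2 * z * M) *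
    ((4 * (C1 * C3)) ^+ (n + q) * (Fk * e))); last by ring.
  rewrite [leRHS](_ : _ = (2 ^+ n)^-1 * (C1 * C2 * z * M) * (C * X)); last by ring.
  apply: ler_wpM2l; last exact: HC.
  by rewrite mulr_ge0 ?mulr_ge0// invr_ge0 ltW.
apply: (@le_trans _ _ (\sum_(k < n.+1) (2 ^+ n)^-1 * (C1 * C2 * C * z * (M * X)))).
  apply: (le_trans (ler_wpM2l _ (HD f m x n sf))); first by rewrite exprn_ge0// addr_ge0.
  by rewrite mulr_sumr; apply: ler_sum => k _; exact: term.
rewrite sumr_const card_ord -mulrnAl ler_piMl//.
  by rewrite !mulr_ge0// expR_ge0.
rewrite -mulr_natl ler_pdivrMr ?exprn_gt0// mul1r -natrX ler_nat.
exact: ltn_expl.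
Qed.

End IterateEstimates.

(** * Seminorms and the topology they generate *)

Section Seminorms.
Variables (R : realType) (omega : R -> R).
Implicit Types (f g : R -> R[i]) (l M : R).

Lemma gs_seminorm_leP l f M : (gs_seminorm omega l f <= M%:E)%E <->
  forall x n q, (1 + `|x|) ^+ q * normc (cderiven n f x) <=
    M * expR (scaled_young omega l (n + q)%:R).
Proof.
have E x n q : ((1 + `|x|) ^+ q * normc (cderiven n f x) <=
    M * expR (scaled_young omega l (n + q)%:R)) =
  ((1 + `|x|) ^+ q * normc (cderiven n f x) *
         expR (- (l * young_conjugate omega ((n + q)%:R / l))) <= M).
  by rewrite expRN ler_pdivrMr ?expR_gt0.
split=> [h x n q|h]; last first.
  by apply: ge_ereal_sup => _ [x [n [q ->]]]; rewrite lee_fin -E h.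
rewrite E -lee_fin; apply: le_trans h; apply: ereal_sup_ubound.
by exists x, n, q.
Qed.

Lemma gs_seminorm_lt l f (eps : R) : 0 < eps ->
  (gs_seminorm omega l f < eps%:E)%E ->
  exists2 M, M < eps & (gs_seminorm omega l f <= M%:E)%E.
Proof.
move=> eps0; case: (gs_seminorm _ _ _) => [r| |]//.
- by rewrite lte_fin => re; exists r.
- by move=> _; exists 0 => //; rewrite leNye.
Qed.

Lemma gs_seminormD l f g M N : smooth f -> smooth g ->
  (gs_seminorm omega l f <= M%:E)%E -> (gs_seminorm omega l g <= N%:E)%E ->
  (gs_seminorm omega l (f + g)%R <= (M + N)%R%:E)%E.
Proof.
move=> sf sg /gs_seminorm_leP hM /gs_seminorm_leP hN; apply/gs_seminorm_leP => x n q.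
have [_] := smooth_lin 1 sf sg; rewrite scale1r => ->; rewrite mul1r.
apply: le_trans (ler_wpM2l _ (le_normcD _ _)) _.
  by rewrite exprn_ge0 ?addr_ge0.
by rewrite mulrDr mulrDl lerD.
Qed.

Lemma gelfand_shilov_schwartz f : gelfand_shilov omega f -> schwartz f.
Proof.
move=> [sf bf]; split=> // n q; have /gs_seminorm_ltP[M HM] := bf 1 ltr01.
have : (gs_seminorm omega 1 f <= M%:E)%E.
  by apply: ge_ereal_sup => _ [x [m [p ->]]]; rewrite lee_fin.
by move=> /gs_seminorm_leP h; eexists => x; exact: h.
Qed.

Lemma gs_space_mem (f : gelfand_shilov_space omega) : gelfand_shilov omega f.
Proof. by case: f => f /= /[!inE]. Qed.

(** Balls around all centres belong to the subbase, so a ball is open by definition and no triangle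
    inequality is involved. *)
Lemma seminorm_ball_nbhs l (eps : R) (f g : gelfand_shilov_space omega) :
  0 < l -> 0 < eps -> seminorm_ball l eps f g -> nbhs g (seminorm_ball l eps f).
Proof.
move=> l0 eps0 fg; exists (seminorm_ball l eps f); split=> //.
exists [set seminorm_ball l eps f]; last by rewrite bigcup_set1.
by move=> _ ->; apply: (@finI_from1 _ _ _ id); exists l, eps, f.
Qed.

(** Open sets are unions of finite intersections of balls, so preimages need testing on balls
    only. *)
Lemma continuous_seminorm_ball (V : topologicalType) (T : V -> gelfand_shilov_space omega) :
  (forall l (eps : R) (f : gelfand_shilov_space omega) v,
     0 < l -> 0 < eps -> seminorm_ball l eps f (T v) ->
     \forall u \near v, seminorm_ball l eps f (T u)) ->
  continuous T.
Proof.
move=> HT v A [_ [[I Ifin] <-] [B /[dup] /(Ifin _) [F Fball <-] IF FTv] IA].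
apply: (filterS IA); apply: (filterS (bigcup_sup IF)); apply: filter_bigI => i Fi.
have /set_mem[l [eps [f [l0 eps0 ie]]]] := Fball _ Fi.
have := FTv i Fi; rewrite /= ie; exact: HT.
Qed.

End Seminorms.

(** * The resolvent: linearity and seminorm bound *)

Lemma schwartz_lin (R : realType) (c : R[i]) (f g : R -> R[i]) :
  schwartz f -> schwartz g -> schwartz (c *: f + g).
Proof.
move=> [sf bf] [sg bg]; have [s e] := smooth_lin c sf sg; split=> // n q.
have [M HM] := bf n q; have [N HN] := bg n q.
exists (normc c * M + N) => x; rewrite e.
apply: le_trans (ler_wpM2l _ (le_normcD _ _)) _.
  by rewrite exprn_ge0 ?addr_ge0.
rewrite mulrDr lerD// normcM mulrCA ler_wpM2l// normc_ge0//.
Qed.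

Section Resolvent.
Variables (R : realType) (psi : {poly R}) (mu : R[i]).
Variable Rmu : (R -> R[i]) -> R -> R[i].
Hypotheses (psi_gt2 : (2 < size psi)%N) (fixpsi : forall x, psi.[x] != x).
Hypotheses (mu0 : mu != 0) (res : is_resolvent mu (horner psi) Rmu).

(** A two-sided inverse of a linear map is linear: both sides have the same image under mu -
    C_psi. *)
Lemma resolvent_lin c f g : schwartz f -> schwartz g ->
  Rmu (c *: f + g) = c *: Rmu f + Rmu g.
Proof.
case: res => RS RK KR Sf Sg.
rewrite -[RHS]RK; last by apply: schwartz_lin; exact: RS.
congr Rmu; apply/funext => x.
have ef := congr1 (fun h => h x) (KR f Sf); have eg := congr1 (fun h => h x) (KR g Sg).
rewrite -[LHS]/(c * f x + g x) -ef -eg /mu_sub_comp.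
rewrite -[RHS]/(mu * (c * Rmu f x + Rmu g x) - (c * Rmu f psi.[x] + Rmu g psi.[x])).
by ring.
Qed.

Let P m := poly_iter psi m.

Lemma normc_resolvent_le f n x N : schwartz f ->
  normc (cderiven n (Rmu f) x) <=
    \sum_(m < N) normc mu ^- m.+1 * normc (cderiven n (f \o horner (P m)) x) +
    normc mu ^- N * normc (cderiven n (Rmu f \o horner (P N)) x).
Proof.
case: res => RS RK KR Sf; have [sf _] := Sf; have [sg _] := RS f Sf.
elim: N => [|N IH].
  rewrite big_ord0 add0r expr0 invr1 mul1r (_ : _ \o _ = Rmu f)//.
  by apply/funext => y; rewrite /= hornerX.
apply: (le_trans IH); rewrite big_ord_recr -addrA lerD2l.
(* The resolvent equation at the point psi_N(y); the trailing 0 gives the inner term the shape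
   required by [smooth_lin]. *)
have E : Rmu f \o horner (P N) =
    mu^-1 *: (f \o horner (P N)) + (mu^-1 *: (Rmu f \o horner (P N.+1)) + 0).
  apply/funext => y.
  have := congr1 (fun h => h (P N).[y]) (KR f Sf); rewrite /mu_sub_comp => e.
  rewrite addr0 -[RHS]/(mu^-1 * f (P N).[y] + mu^-1 * Rmu f (P N.+1).[y]).
  by rewrite -e horner_poly_iterS -mulrDr subrK mulKf.
have sP m h : smooth h -> smooth (h \o horner (P m)).
  by move=> sh; have [] := normc_comp_poly (P m) sh.
have [z0 z0E] := smooth0 R.
have [s1 E1] := smooth_lin mu^-1 (sP N.+1 _ sg) z0.
have [_ E2] := smooth_lin mu^-1 (sP N _ sf) s1.
rewrite E E2 E1 z0E addr0.
apply: (le_trans (ler_wpM2l _ (le_normcD _ _))).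
  by rewrite invr_ge0 exprn_ge0// normc_ge0.
by rewrite mulrDr !normcM !normcV !mulrA -!invfM -!exprSr.
Qed.

Lemma gs_resolvent_le (omega : R -> R) (l a : R) :
  subadditive_weight omega -> 0 < l -> 2 < a ->
  exists2 C, 0 <= C & forall f M, schwartz f -> 0 <= M ->
    (gs_seminorm omega l f <= M%:E)%E ->
    (gs_seminorm (fun t : R => omega (t `^ a^-1)%R) l (Rmu f) <= (C * M)%R%:E)%E.
Proof.
move=> s_omega l0 a2.
have [C C0 HC] := gs_comp_poly_iter psi_gt2 fixpsi mu0 s_omega l0 a2.
have nmu0 : 0 < normc mu.
  rewrite lt_neqAle normc_ge0 andbT eq_sym; apply: contra mu0 => /eqP h.
  by rewrite (eq0_normc h).
have a0 : 0 < a by exact: lt_trans a2.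
(* The factors |mu|^-(m+1) (|mu|/2)^m sum to less than 2/|mu|. *)
exists (2 * (C / normc mu)); first by rewrite mulr_ge0// divr_ge0// ltW.
move=> f M Sf M0 /gs_seminorm_leP HM; apply/gs_seminorm_leP => x n q.
have {HC}HC := HC f M Sf.1 M0 HM.
have -> : scaled_young (fun t => omega (t `^ a^-1)) l (n + q)%:R =
    scaled_young omega l (a * (n + q)%:R) by rewrite /scaled_young young_powR// mulrA.
set X := expR _.
have [Y HY] := schwartz_comp_poly_iter psi_gt2 fixpsi mu0 n x
  (match res with And3 RS _ _ => RS f Sf end).
have half m : normc mu ^- m * (normc mu / 2) ^+ m = 2 ^- m.
  by rewrite exprMn exprVn mulKf// expf_neq0// gt_eqF.
have V0 m : 0 <= normc mu ^- m by rewrite invr_ge0 exprn_ge0// ltW.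
set W := (1 + `|x|) ^+ q; have W0 : 0 <= W by rewrite exprn_ge0// addr_ge0.
have X0 : 0 <= X by exact: expR_ge0.
have bound N : W * normc (cderiven n (Rmu f) x) <=
    2 * (C / normc mu) * M * X + W * `|Y| * 2 ^- N.
  apply: (le_trans (ler_wpM2l W0 (normc_resolvent_le n x N Sf))).
  rewrite mulrDr mulr_sumr lerD//.
    apply: (@le_trans _ _ (\sum_(m < N) (C / normc mu) * M * X * 2 ^- m)).
      apply: ler_sum => m _; rewrite mulrCA.
      apply: (le_trans (ler_wpM2l (V0 _) (HC m x n q))).
      rewrite le_eqVlt; apply/orP; left; apply/eqP; rewrite -half exprS invfM -/X.
      by ring.
    rewrite -mulr_sumr [leRHS](_ : _ = C / normc mu * M * X * 2); last by ring.
    rewrite ler_wpM2l ?mulr_ge0 ?invr_ge0 ?(ltW nmu0)//.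
    have -> : \sum_(m < N) 2 ^- m = 2 - 2 * 2 ^- N :> R.
      elim: {+}N => [|k IH]; first by rewrite big_ord0 expr0; field.
      rewrite big_ord_recr/= IH exprS invfM; by field; rewrite expf_neq0.
    by rewrite gerBl mulr_ge0// invr_ge0 exprn_ge0.
  rewrite -[leRHS]mulrA ler_wpM2l//.
  apply: (le_trans (ler_wpM2l (V0 N) (HY N))); rewrite mulrCA half.
  by rewrite ler_wpM2r ?invr_ge0 ?exprn_ge0// ler_norm.
(* The remainder W |Y| 2^-N falls below any e > 0 for large N, since 2^N > N; only the part uniform
   in x survives. *)
apply/ler_addgt0Pr => e e0.
have [N HN] : exists N : nat, W * `|Y| / e < N%:R.
  exists (Num.bound (W * `|Y| / e)); apply: archi_boundP.
  by apply: divr_ge0; [exact: mulr_ge0|exact: ltW].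
apply: (le_trans (bound N)); rewrite lerD2l.
rewrite ler_pdivrMr ?exprn_gt0// [leRHS]mulrC -ler_pdivrMr//.
by apply/ltW/(lt_trans HN); rewrite -natrX ltr_nat ltn_expl.
Qed.

End Resolvent.

(** * The resolvent as a continuous linear map between the two spaces *)

Unset Implicit Arguments.

Theorem proposition4p3 (R : realType) (omega : R -> R) (a : R)
    (psi : {poly R}) (mu : R[i]) (Rmu : (R -> R[i]) -> R -> R[i])
    (homega : subadditive_weight omega) (ha : 2 < a)
    (hdeg : (2 < size psi)%N) (hfix : forall x : R, psi.[x] != x)
    (hmu : mu != 0)
    (hRmu : is_resolvent mu (fun x => psi.[x]) Rmu) :
  let sigma := fun t : R => omega (t `^ a^-1) in
  exists T : {linear gelfand_shilov_space omega -> gelfand_shilov_space sigma},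
    (forall f : gelfand_shilov_space omega, gs_fun (T f) = Rmu (gs_fun f)) /\
    continuous T.
Proof.
move=> sigma.
have Sw (f : gelfand_shilov_space omega) := gelfand_shilov_schwartz (gs_space_mem f).
have Rgs f : gelfand_shilov omega f -> gelfand_shilov sigma (Rmu f).
  move=> gf; have Sf := gelfand_shilov_schwartz gf; split.
    by case: hRmu => /(_ f Sf)[].
  move=> l l0; have [C C0 HC] := gs_resolvent_le hdeg hfix hmu hRmu homega l0 ha.
  have /gs_seminorm_ltP[M HM] := gf.2 l l0.
  have M0 : 0 <= M.
    apply: le_trans (HM 0 0%N 0%N).
    by rewrite !mulr_ge0 ?expR_ge0 ?exprn_ge0 ?addr_ge0 ?normc_ge0.
  apply: le_lt_trans (HC f M Sf M0 _) (ltry _).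
  by apply: ge_ereal_sup => _ [x [m [p ->]]]; rewrite lee_fin.
pose T0 (f : gelfand_shilov_space omega) : gelfand_shilov_space sigma :=
  GelfandShilovSpace (mem_set (Rgs _ (gs_space_mem f))).
have T0lin : linear T0.
  move=> c f g; apply: val_inj; exact: (resolvent_lin hRmu c (Sw f) (Sw g)).
pose T : {linear gelfand_shilov_space omega -> gelfand_shilov_space sigma} :=
  HB.pack T0 (GRing.isLinear.Build _ _ _ _ T0 T0lin).
exists T; split=> //; apply: continuous_seminorm_ball => l eps f g l0 eps0.
move=> /(gs_seminorm_lt eps0)[M Meps HM].
have [C C0 HC] := gs_resolvent_le hdeg hfix hmu hRmu homega l0 ha.
(* The radius is chosen so that C d + M < eps; C + 1 avoids division by zero. *)
pose d := (eps - M) / (C + 1).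
have C10 : 0 < C + 1 by rewrite ltr_wpDl.
have d0 : 0 < d by rewrite divr_gt0// subr_gt0.
apply: (filterS _ (@seminorm_ball_nbhs _ _ l d g g l0 d0 _)); last first.
  rewrite /seminorm_ball/= subrr.
  apply: (@le_lt_trans _ _ 0%:E); last by rewrite lte_fin.
  apply/gs_seminorm_leP => x n q; have [_ E] := smooth0 R.
  by rewrite (E n x) normc0 mulr0 mul0r.
move=> h /(gs_seminorm_lt d0)[N Nd HN].
have HTN : (gs_seminorm sigma l (gs_fun (T (h - g)%R)) <= (C * d)%R%:E)%E.
  apply: HC; [exact: Sw|exact: ltW|].
  by apply: le_trans HN _; rewrite lee_fin ltW.
(* By linearity, the distance from T h to the centre f splits into a part controlled by h - g and
   the old distance from T g. *)
have E : gs_fun (T h - f) = gs_fun (T (h - g)) + gs_fun (T g - f).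
  rewrite -[RHS]/(gs_fun (T (h - g) + (T g - f))) linearB addrA subrK//.
rewrite /seminorm_ball /mkset E.
apply: (@le_lt_trans _ _ (C * d + M)%:E).
  by apply: gs_seminormD; [exact: (gs_space_mem _).1|exact: (gs_space_mem _).1|..].
rewrite lte_fin -ltrBrDr /d mulrA ltr_pdivrMr// mulrC.
by rewrite ltr_pM2l ?subr_gt0// ltrDl.
Qed.
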